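(* Let $G$ be a graph containing a hamilton circuit $H_C$, and let $H_0$ be a pseudo-hamilton circuit each of whose edges lies in $K_n-G$. Then there always exists a sequence of successive $H_i$-admissible permutations $s_i$ ($i=0,1,2,\dots$), each of which is a 3-cycle or a product of two disjoint 2-cycles, that obtains $H_C$. That is, with $H_{i+1}=H_is_i$, one has $H_r=H_C$ for some finite $r$.
   Context: $G$ is a graph on $n$ vertices and $K_n$ is the complete graph on the same vertices. A pseudo-hamilton circuit is an $n$-cycle on the vertices, whose arcs need not belong to $G$. A hamilton circuit is one all of whose arcs come from edges of $G$. For an $n$-cycle $H$ and a permutation $s$, $Hs$ denotes the permutation $v\mapsto H(s(v))$. A permutation $s$ (a 3-cycle or a product of two disjoint 2-cycles) is $H$-admissible if $Hs$ is again an $n$-cycle. *)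

(* Defs.v *)
From mathcomp Require Import all_boot all_fingroup.

Set Implicit Arguments.
Unset Strict Implicit.
Unset Printing Implicit Defensive.

(* [next c x] is the cyclic successor of [x] in [c], and [x] itself when *)
(* [x \notin c]; so [h] is the cycle (c_0 c_1 ... c_(k-1)).              *)
Definition is_cycle (T : finType) (k : nat) (h : {perm T}) : Prop :=
  exists2 c : k.-tuple T, uniq c & h =1 next c.

Definition psupport (T : finType) (h : {perm T}) : {set T} := [set x | h x != x].

(* v |-> h (s v); MathComp's group product of permutations applies its *)
(* left factor first, whence the swap.                                 *)
Definition comp_perm (T : finType) (h s : {perm T}) : {perm T} := (s * h)%g.

Definition two_disjoint_2cycles (T : finType) (s : {perm T}) : Prop :=
  exists t1 t2 : {perm T},
    [/\ is_cycle 2 t1, is_cycle 2 t2,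
        [disjoint psupport t1 & psupport t2] & s = comp_perm t1 t2].

Definition pseudo_hamilton (T : finType) (h : {perm T}) : Prop := is_cycle #|T| h.

Definition admissible (T : finType) (h s : {perm T}) : Prop :=
  (is_cycle 3 s \/ two_disjoint_2cycles s) /\ pseudo_hamilton (comp_perm h s).

Definition simple_graph (T : finType) (G : rel T) : Prop := symmetric G /\ irreflexive G.

(* The graph K_n - G. *)
Definition graph_compl (T : finType) (G : rel T) : rel T :=
  fun x y => (x != y) && ~~ G x y.

(* The arcs of [h] are the pairs (v, h v). *)
Definition arcs_in (T : finType) (G : rel T) (h : {perm T}) : Prop := forall v, G v (h v).

Definition hamilton (T : finType) (G : rel T) (h : {perm T}) : Prop :=
  pseudo_hamilton h /\ arcs_in G h.

(* Main.v *)
(* Conjugating an n-cycle h by a transposition t gives again an n-cycle, and   *)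
(* t^-1 h t = h s where s is the product of t with the conjugate transposition *)
(* h^-1 t h; so s is trivial, a 3-cycle, or a product of two disjoint          *)
(* 2-cycles. As any two n-cycles are conjugate and transpositions generate the *)
(* symmetric group, such steps lead from any n-cycle to any other one.         *)
Require Import Defs.
From mathcomp Require Import all_boot all_fingroup.

Import GroupScope.

(** Matching cyclic orders gives [HC = H0 ^ p] ([is_cycle_conjugate]). Writing [p] as a product of
    transpositions turns this into successive conjugations by one transposition, all of whose
    results are $n$-cycles ([is_cycle_conjg]). Each is a single admissible step or changes nothing
    ([reachable_tpermJ]), by the classification in [tpermM_shape]. *)

Lemma is_cycle_conjg {T : finType} {k : nat} {h : {perm T}} (p : {perm T}) :
  is_cycle k h -> is_cycle k (h ^ p).
Proof.
case=> c Uc hE; exists (map_tuple p c); first by rewrite map_inj_uniq //; exact: perm_inj.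
by move=> x; rewrite -(permKV p x) permJ hE next_map //; exact: perm_inj.
Qed.

Lemma is_cycle_conjugate {T : finType} (h g : {perm T}) :
  is_cycle #|T| h -> is_cycle #|T| g -> exists p, g = h ^ p.
Proof.
case=> c Uc hE [d Ud gE].
have memc : c =i predT.
  by apply/subset_cardP; rewrite ?subset_predT // (card_uniqP Uc) size_tuple.
(* The conjugator sends the $i$-th entry of [c] to the $i$-th entry of [d]; both tuples list every
   point, so the default [x] is never returned. *)
pose f x := nth x d (index x c).
have ltc x : index x c < size d by rewrite size_tuple -[X in _ < X](size_tuple c) index_mem memc.
have f_inj : injective f.
  move=> x y; rewrite /f (set_nth_default y x) // => /eqP.
  by rewrite nth_uniq //; move=> /eqP; apply: (index_inj x); rewrite memc.
exists (perm f_inj); apply/permP => x0.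
have dE : d = map f c :> seq T.
  apply: (@eq_from_nth _ x0) => [|i id_]; first by rewrite size_map !size_tuple.
  have ic : i < size c by move: id_; rewrite !size_tuple.
  by rewrite (nth_map x0) // /f index_uniq //; apply: set_nth_default.
by rewrite -(permKV (perm f_inj) x0) permJ hE gE !permE dE next_map.
Qed.

Lemma is_cycle_tperm {T : finType} (x y : T) : x != y -> is_cycle 2 (tperm x y).
Proof.
move=> xy; exists [tuple x; y]; first by rewrite /= inE xy.
move=> z /=; case: tpermP => [->|->|/eqP/negPf-> /eqP/negPf->] //.
  by rewrite eqxx.
by rewrite eqxx eq_sym (negPf xy).
Qed.

Lemma is_cycle_tpermM {T : finType} (x y z : T) :
  uniq [:: x; y; z] -> is_cycle 3 (tperm x y * tperm x z).
Proof.
move=> U; exists [tuple x; y; z] => // w.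
move: U; rewrite /= !inE negb_or andbT => /andP[/andP[xy xz] yz].
rewrite permM /=; case: (tpermP x y w) => [->|->|/eqP wx /eqP wy].
- by rewrite eqxx tpermD // eq_sym.
- by rewrite tpermL eq_sym (negPf xy) eqxx.
rewrite (negPf wx) (negPf wy).
by case: tpermP wx => [->|->|_ /eqP/negPf->]; rewrite ?eqxx.
Qed.

(** The three outcomes correspond to the two transpositions sharing two points, one point or
    none. *)
Lemma tpermM_shape {T : finType} (x y u v : T) : x != y -> u != v ->
  [\/ tperm x y * tperm u v = 1, is_cycle 3 (tperm x y * tperm u v)
    | two_disjoint_2cycles (tperm x y * tperm u v)].
Proof.
have share a b c : a != b -> a != c ->
    [\/ tperm a b * tperm a c = 1, is_cycle 3 (tperm a b * tperm a c)
      | two_disjoint_2cycles (tperm a b * tperm a c)].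
  move=> ab ac; have [<-|bc] := eqVneq b c; first by apply: Or31; rewrite tperm2.
  by apply/Or32/is_cycle_tpermM; rewrite /= !inE negb_or ab ac bc.
move=> xy uv; have vu : v != u by rewrite eq_sym.
have yx : y != x by rewrite eq_sym.
have [xu|xu] := eqVneq x u; first by subst u; apply: share.
have [xv|xv] := eqVneq x v; first by subst v; rewrite [tperm u x]tpermC; apply: share.
have [yu|yu] := eqVneq y u; first by subst u; rewrite [tperm x y]tpermC; apply: share.
have [yv|yv] := eqVneq y v.
  by subst v; rewrite [tperm x y]tpermC [tperm u y]tpermC; apply: share.
(* The factors are swapped because [comp_perm] applies its second argument first. *)
apply: Or33; exists (tperm u v), (tperm x y); split=> //; try exact: is_cycle_tperm.
rewrite disjoint_subset; apply/subsetP => z; rewrite !inE negbK.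
case: (tpermP u v z) => [-> _|-> _|]; rewrite ?eqxx // tpermD //.
Qed.

(** The conclusion of the theorem with both ends free, for use in an induction. *)
Definition reachable {T : finType} (A B : {perm T}) : Prop :=
  exists (r : nat) (H s : nat -> {perm T}),
    [/\ H 0 = A,
        forall i, i < r -> admissible (H i) (s i) /\ H i.+1 = comp_perm (H i) (s i)
      & H r = B].

Lemma reachable_step {T : finType} (A B s : {perm T}) :
  admissible A s -> reachable (comp_perm A s) B -> reachable A B.
Proof.
move=> As [r [H [s' [H0 Hs Hr]]]].
exists r.+1, (fun i => if i is j.+1 then H j else A).
exists (fun i => if i is j.+1 then s' j else s).
by split=> // -[_|i ir] /=; [rewrite H0 | apply: Hs].
Qed.

Lemma reachable_tpermJ {T : finType} (A B : {perm T}) (x y : T) : x != y ->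
  pseudo_hamilton A -> reachable (A ^ tperm x y) B -> reachable A B.
Proof.
move=> xy hA; pose s := tperm x y * tperm x y ^ A^-1.
have sE : A ^ tperm x y = comp_perm A s.
  by rewrite /comp_perm /s !conjgE tpermV invgK !mulgA mulgKV.
have := is_cycle_conjg (tperm x y) hA; rewrite sE => hAs.
have : [\/ s = 1, is_cycle 3 s | two_disjoint_2cycles s].
  by rewrite /s tpermJ; apply: tpermM_shape; rewrite ?(inj_eq perm_inj).
(* If [s] is trivial, conjugation leaves [A] unchanged and no step is taken. *)
case=> [s1|s3|s22]; first by rewrite s1 /comp_perm mul1g.
- by apply: reachable_step; split; first left.
- by apply: reachable_step; split; first right.
Qed.

Theorem theorem1p10 (T : finType) (G : rel T) (HC H0 : {perm T})
    (hG : simple_graph G)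
    (hHC : hamilton G HC)
    (hH0 : pseudo_hamilton H0)
    (hH0G : arcs_in (graph_compl G) H0) :
  exists (r : nat) (H s : nat -> {perm T}),
    [/\ H 0 = H0,
        forall i, i < r -> admissible (H i) (s i) /\ H i.+1 = comp_perm (H i) (s i)
      & H r = HC].
Proof.
have [p ->] : exists p, HC = H0 ^ p by case: hHC => hHC _; apply: is_cycle_conjugate.
have [ts -> {p}] := prod_tpermP p; rewrite -/(reachable _ _).
(* The starting circuit must vary: the head transposition conjugates first, and the induction
   continues from the conjugate. *)
elim: ts H0 hH0 {hH0G} => [|[x y] ts IH] A hA /=.
  by exists 0, (fun=> A), (fun=> 1); rewrite big_nil conjg1.
case/andP=> xy dts; rewrite big_cons conjgM; apply: (reachable_tpermJ _ _ _ _ xy hA).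
by apply: IH => //; apply: is_cycle_conjg.
Qed.
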